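(* The assignment $X \mapsto \mathsf{C}(X)$, $f \mapsto \mathsf{C}(f)$, where $\mathsf{C}(f)(A) = f(A)^{\perp\perp}$, is a faithful, dagger essentially surjective, dagger-preserving functor $\mathsf{C}$ from the dagger category $\mathcal{iOS}$ to the dagger category $\mathcal{cOL}$.
   Context: An orthoset (with $0$) is a non-empty set $X$ with a binary relation $\perp$ and element $0$ such that: $\perp$ is symmetric; $x \perp x$ iff $x=0$; $0 \perp x$ for all $x$. For $A \subseteq X$, $A^\perp = \{x : x \perp y\ \forall y \in A\}$; $\mathsf{C}(X) = \{A \subseteq X : A = A^{\perp\perp}\}$, a complete ortholattice under inclusion with orthocomplement $A \mapsto A^\perp$. $X$ is irredundant if for proper (i.e. nonzero) $x,y$, $\{x\}^\perp = \{y\}^\perp$ implies $x=y$. A map $f\colon X\to Y$ is adjointable if there is $g\colon Y\to X$ with $f(x)\perp y \iff x \perp g(y)$ for all $x,y$; between irredundant orthosets the adjoint is unique and denoted $f^\star$. $\mathcal{iOS}$ is the category of irredundant orthosets and adjointable maps, a dagger category with dagger $f \mapsto f^\star$. Any complete ortholattice $L$ is regarded as an (irredundant) orthoset $L^{\mathrm{OS}}$ with $a \perp b$ iff $a \le b^\perp$ and $0$ the bottom; $\mathcal{cOL}$ is the full dagger subcategory of $\mathcal{iOS}$ whose objects are the complete ortholattices (as orthosets), morphisms the adjointable maps, dagger the unique adjoint. A dagger isomorphism is a morphism $f$ with $f^\star f = \mathrm{id}$ and $f f^\star = \mathrm{id}$; a functor $F$ is dagger-preserving if $F(f^\star) = F(f)^\star$,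 and dagger essentially surjective if every object of the target is dagger isomorphic to some $F(X)$. *)

(* Defs.v *)
From HB Require Import structures.
From mathcomp Require Import all_boot all_order.
From mathcomp Require Import boolp classical_sets.

Set Implicit Arguments.
Unset Strict Implicit.
Unset Printing Implicit Defensive.

Import Order.TTheory.
Local Open Scope classical_set_scope.

HB.mixin Record isOrthoset X := {
  perp : X -> X -> Prop;
  ozero : X;
  perp_sym : forall x y, perp x y -> perp y x;
  perpxx : forall x, perp x x <-> x = ozero;
  perp0x : forall x, perp ozero x
}.

#[short(type="orthosetType")]
HB.structure Definition Orthoset := {X of isOrthoset X}.

Arguments ozero {s}.

Definition orth (X : orthosetType) (A : set X) : set X :=
  [set x | forall y, A y -> perp x y].

HB.mixin Record Orthoset_isIrredundant X of Orthoset X := {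
  irredundantP : forall x y : X, x <> ozero -> y <> ozero ->
    orth [set x] = orth [set y] -> x = y
}.

#[short(type="irrOrthosetType")]
HB.structure Definition IrrOrthoset :=
  {X of Orthoset X & Orthoset_isIrredundant X}.

Definition is_adjoint (X Y : orthosetType) (f : X -> Y) (g : Y -> X) :=
  forall x y, perp (f x) y <-> perp x (g y).

Definition adjointable (X Y : orthosetType) (f : X -> Y) :=
  exists g : Y -> X, is_adjoint f g.

Record adjMap (X Y : orthosetType) := AdjMap {
  adj_fun :> X -> Y;
  adj_funP : adjointable adj_fun
}.

HB.mixin Record TBLattice_isOrtholattice (d : Order.disp_t) L
    of Order.TBLattice d L := {
  ocompl : L -> L;
  ocomplK : involutive ocompl;
  ocompl_anti : forall x y : L, (x <= y)%O -> (ocompl y <= ocompl x)%O;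
  meetxCo : forall x : L, (x `&` ocompl x = \bot)%O;
  joinxCo : forall x : L, (x `|` ocompl x = \top)%O
}.

#[short(type="ortholatticeType")]
HB.structure Definition Ortholattice d :=
  {L of Order.TBLattice d L & TBLattice_isOrtholattice d L}.

HB.mixin Record POrder_isComplete (d : Order.disp_t) L of Order.POrder d L := {
  completeP : forall A : set L, supremums A !=set0
}.

#[short(type="completeOrtholatticeType")]
HB.structure Definition CompleteOrtholattice d :=
  {L of Ortholattice d L & POrder_isComplete d L}.

Definition lattice_orthoset d (L : completeOrtholatticeType d) : Type := L.

Section LatticeOrthoset.
Context d (L : completeOrtholatticeType d).
Local Notation LOS := (lattice_orthoset L).

Definition lperp (a b : LOS) : Prop := ((a : L) <= ocompl (b : L))%O.

Lemma lperp_sym a b : lperp a b -> lperp b a.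
Proof. by move=> /ocompl_anti; rewrite ocomplK. Qed.

Lemma lperpxx a : lperp a a <-> a = \bot%O :> L.
Proof.
split=> [|->]; last exact: le0x.
by rewrite /lperp leEmeet meetxCo => /eqP ->.
Qed.

Lemma lperp0x a : lperp (\bot%O : L) a.
Proof. exact: le0x. Qed.

HB.instance Definition _ :=
  isOrthoset.Build LOS lperp_sym lperpxx lperp0x.

Lemma lirredundant (x y : LOS) : x <> ozero -> y <> ozero ->
  orth [set x] = orth [set y] -> x = y.
Proof.
move=> _ _ /predeqP E; apply: (can_inj (@ocomplK _ L)); apply/le_anti/andP.
have orth1 (u v : LOS) : orth [set v] u <-> lperp u v.
  by split=> [/(_ v erefl)|uv _ ->].
by split; [apply/orth1/E/orth1|apply/orth1/E/orth1]; apply: lexx.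
Qed.

HB.instance Definition _ := Orthoset_isIrredundant.Build LOS lirredundant.

End LatticeOrthoset.

Section ClosedSets.
Context (X : orthosetType).
Implicit Types A B : set X.

Record closedSet := ClosedSet {
  closed_set :> set X;
  closed_setP : orth (orth closed_set) = closed_set
}.

Lemma closedSet_inj : injective closed_set.
Proof.
move=> [A hA] [B hB] /= E; case: B / E hB => hB.
by rewrite (Prop_irrelevance hA hB).
Qed.

Lemma orthS A B : A `<=` B -> orth B `<=` orth A.
Proof. by move=> AB x hx y /AB; apply: hx. Qed.

Lemma orth_sub A : A `<=` orth (orth A).
Proof. by move=> x Ax y /(_ x Ax); apply: perp_sym. Qed.

Lemma orth3 A : orth (orth (orth A)) = orth A.
Proof.
by apply/seteqP; split; [apply/orthS/orth_sub|apply: orth_sub].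
Qed.

Definition corth A : closedSet := ClosedSet (orth3 A).

HB.instance Definition _ := gen_eqMixin closedSet.
HB.instance Definition _ := gen_choiceMixin closedSet.

Definition cle (A B : closedSet) : bool := `[< A `<=` B >].

Lemma cleP (A B : closedSet) : reflect (A `<=` B) (cle A B).
Proof. exact: asboolP. Qed.

Lemma cle_refl : reflexive cle.
Proof. by move=> A; apply/cleP. Qed.

Lemma cle_anti : antisymmetric cle.
Proof.
move=> A B /andP[/cleP AB /cleP BA].
by apply: closedSet_inj; apply/seteqP.
Qed.

Lemma cle_trans : transitive cle.
Proof.
by move=> B A C /cleP AB /cleP BC; apply/cleP; apply: subset_trans AB BC.
Qed.

(* Displays only drive the printing of order notations. *)
Fact closedSet_display : Order.disp_t. Proof. exact: Order.Disp tt tt. Qed.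

HB.instance Definition _ :=
  Order.Le_isPOrder.Build closedSet_display closedSet cle_refl cle_anti
    cle_trans.

Lemma closedSet_leP (A B : closedSet) : reflect (A `<=` B) (A <= B)%O.
Proof. exact: cleP. Qed.

Lemma orthU A B : orth (A `|` B) = orth A `&` orth B.
Proof.
apply/seteqP; split=> [x h|x [hA hB] y [/hA|/hB] //].
by split=> y ?; apply: h; [left|right].
Qed.

Lemma orth_least A (C : closedSet) : orth (orth A) `<=` C <-> A `<=` C.
Proof.
split=> [|AC]; first exact: subset_trans (@orth_sub A).
by rewrite -(closed_setP C); do 2 apply: orthS.
Qed.

Definition cmeet (A B : closedSet) := corth (orth A `|` orth B).
Definition cjoin (A B : closedSet) := corth (orth (A `|` B)).

Lemma cmeetE (A B : closedSet) : cmeet A B = A `&` B :> set X.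
Proof. by rewrite /= orthU !closed_setP. Qed.

Lemma cmeetP (A B C : closedSet) :
  (A <= cmeet B C)%O = (A <= B)%O && (A <= C)%O.
Proof.
apply/closedSet_leP/andP; rewrite cmeetE.
  by rewrite subsetI => -[? ?]; split; apply/closedSet_leP.
by move=> [/closedSet_leP ? /closedSet_leP ?]; rewrite subsetI.
Qed.

Lemma cjoinP (A B C : closedSet) :
  (cjoin A B <= C)%O = (A <= C)%O && (B <= C)%O.
Proof.
apply/closedSet_leP/andP.
  by move=> /orth_least; rewrite subUset => -[? ?]; split; apply/closedSet_leP.
by move=> [/closedSet_leP ? /closedSet_leP ?]; apply/orth_least; rewrite subUset.
Qed.

HB.instance Definition _ :=
  Order.POrder_MeetJoin_isLattice.Build closedSet_display closedSet
    cmeetP cjoinP.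

Definition cbot : closedSet := corth setT.
Definition ctop : closedSet := corth set0.

Lemma cbotP (A : closedSet) : (cbot <= A)%O.
Proof.
by apply/closedSet_leP; rewrite -(closed_setP A); apply: orthS.
Qed.

Lemma ctopP (A : closedSet) : (A <= ctop)%O.
Proof. by apply/closedSet_leP => x _ y []. Qed.

HB.instance Definition _ :=
  Order.hasBottom.Build closedSet_display closedSet cbotP.
HB.instance Definition _ :=
  Order.hasTop.Build closedSet_display closedSet ctopP.

Definition cocompl (A : closedSet) : closedSet := corth A.

Lemma cocomplK : involutive cocompl.
Proof. by move=> A; apply: closedSet_inj; apply: closed_setP. Qed.

Lemma cocompl_anti (A B : closedSet) :
  (A <= B)%O -> (cocompl B <= cocompl A)%O.
Proof. by move=> /closedSet_leP AB; apply/closedSet_leP/orthS. Qed.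

Lemma cmeetxCo (A : closedSet) : (A `&` cocompl A = \bot)%O.
Proof.
apply/le_anti; rewrite le0x andbT; apply/closedSet_leP => x.
rewrite cmeetE => -[Ax /(_ x Ax) /perpxx ->] y _; exact: perp0x.
Qed.

Lemma cjoinxCo (A : closedSet) : (A `|` cocompl A = \top)%O.
Proof.
apply/le_anti; rewrite lex1 /=; apply/closedSet_leP => x _.
rewrite -[(_ `|` _)%O]/(cjoin A (cocompl A)) => y; rewrite orthU => -[yA /(_ y yA) /perpxx ->].
by apply: perp_sym; apply: perp0x.
Qed.

HB.instance Definition _ :=
  TBLattice_isOrtholattice.Build closedSet_display closedSet
    cocomplK cocompl_anti cmeetxCo cjoinxCo.

Lemma closedSet_complete (S : set closedSet) : supremums S !=set0.
Proof.
exists (corth (orth (\bigcup_(A in S) closed_set A))); split=> [A SA|B ubB].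
  by apply/closedSet_leP => x Ax; apply: orth_sub; exists A.
apply/closedSet_leP/orth_least; apply: bigcup_sub => A SA.
exact/closedSet_leP/ubB.
Qed.

HB.instance Definition _ :=
  POrder_isComplete.Build closedSet_display closedSet closedSet_complete.

End ClosedSets.

Record daggerCategory := DaggerCategory {
  obj :> Type;
  hom : obj -> obj -> Type;
  idm : forall a, hom a a;
  compm : forall a b c, hom b c -> hom a b -> hom a c;
  dagger : forall a b, hom a b -> hom b a;
  compmA : forall a b c d (h : hom c d) (g : hom b c) (f : hom a b),
    compm h (compm g f) = compm (compm h g) f;
  comp1m : forall a b (f : hom a b), compm (idm b) f = f;
  compm1 : forall a b (f : hom a b), compm f (idm a) = f;
  dagger_id : forall a, dagger (idm a) = idm a;
  dagger_comp : forall a b c (g : hom b c) (f : hom a b),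
    dagger (compm g f) = compm (dagger f) (dagger g);
  daggerK : forall a b (f : hom a b), dagger (dagger f) = f
}.

Arguments idm {d} a : rename.

Definition full_dagger_subcategory (D : daggerCategory) (I : Type)
    (i : I -> D) : daggerCategory :=
  {| obj := I;
     hom := fun a b => hom (i a) (i b);
     idm := fun a => idm (i a);
     compm := fun a b c g f => compm g f;
     dagger := fun a b f => dagger f;
     compmA := fun a b c d h g f => compmA h g f;
     comp1m := fun a b f => comp1m f;
     compm1 := fun a b f => compm1 f;
     dagger_id := fun a => dagger_id (i a);
     dagger_comp := fun a b c g f => dagger_comp g f;
     daggerK := fun a b f => daggerK f |}.

Definition dagger_isomorphism (D : daggerCategory) (a b : D) (f : hom a b) :=
  compm (dagger f) f = idm a /\ compm f (dagger f) = idm b.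

Section Functors.
Context (D E : daggerCategory) (F0 : D -> E).
Context (F : forall a b : D, hom a b -> hom (F0 a) (F0 b)).

Definition is_functor :=
  (forall a : D, F (idm a) = idm (F0 a)) /\
  (forall (a b c : D) (g : hom b c) (f : hom a b),
     F (compm g f) = compm (F g) (F f)).

Definition faithful :=
  forall (a b : D) (f g : hom a b), F f = F g -> f = g.

Definition dagger_preserving :=
  forall (a b : D) (f : hom a b), F (dagger f) = dagger (F f).

Definition dagger_essentially_surjective :=
  forall e : E, exists (a : D) (f : hom (F0 a) e), dagger_isomorphism f.

End Functors.

Section AdjointableMaps.

Lemma adjMap_eq (X Y : orthosetType) (f g : adjMap X Y) : f =1 g -> f = g.
Proof.
case: f g => [f hf] [g hg] /= /funext E; case: g / E hg => hg.
by rewrite (Prop_irrelevance hf hg).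
Qed.

Lemma is_adjoint_sym (X Y : orthosetType) (f : X -> Y) (g : Y -> X) :
  is_adjoint f g -> is_adjoint g f.
Proof.
move=> fg y x; split=> [/perp_sym/fg/perp_sym //|].
by move=> /perp_sym/fg/perp_sym.
Qed.

Lemma is_adjoint_id (X : orthosetType) : is_adjoint (@id X) id.
Proof. by []. Qed.

Lemma is_adjoint_comp (X Y Z : orthosetType) (g : Y -> Z) (f : X -> Y) g' f' :
  is_adjoint g g' -> is_adjoint f f' -> is_adjoint (g \o f) (f' \o g').
Proof. by move=> gg' ff' x z; split=> [/gg'/ff'|/ff'/gg']. Qed.

Lemma is_adjoint_unique (X : irrOrthosetType) (Y : orthosetType)
    (f : X -> Y) (g h : Y -> X) :
  is_adjoint f g -> is_adjoint f h -> g = h.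
Proof.
move=> fg fh; apply/funext => y.
have E x : perp x (g y) <-> perp x (h y).
  by split=> [/fg/fh|/fh/fg].
have [g0|g0] := pselect (g y = ozero).
  rewrite g0; apply/esym/perpxx/E.
  by rewrite g0; apply: perp_sym; apply: perp0x.
have [h0|h0] := pselect (h y = ozero).
  rewrite h0; apply/perpxx/E.
  by rewrite h0; apply: perp_sym; apply: perp0x.
apply: irredundantP => //; apply/seteqP.
by split=> x /(_ _ erefl) hx _ ->; apply/E.
Qed.

Definition adj_id (X : orthosetType) : adjMap X X :=
  AdjMap (ex_intro _ _ (@is_adjoint_id X)).

Lemma adjointable_comp (X Y Z : orthosetType)
  (g : adjMap Y Z) (f : adjMap X Y) : adjointable (g \o f).
Proof.
case: g f => [g [g' gg']] [f [f' ff']]; exists (f' \o g').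
exact: is_adjoint_comp.
Qed.

Definition adj_comp (X Y Z : orthosetType)
  (g : adjMap Y Z) (f : adjMap X Y) : adjMap X Z :=
  AdjMap (adjointable_comp g f).

Definition star_fun (X Y : orthosetType) (f : adjMap X Y) : Y -> X :=
  projT1 (cid (adj_funP f)).

Lemma star_funP (X Y : orthosetType) (f : adjMap X Y) :
  is_adjoint f (star_fun f).
Proof. by rewrite /star_fun; case: cid. Qed.

(* f^star; between irredundant orthosets it is the unique adjoint of f, by
   star_funP and is_adjoint_unique. *)
Definition star (X Y : orthosetType) (f : adjMap X Y) : adjMap Y X :=
  AdjMap (ex_intro _ _ (is_adjoint_sym (star_funP f))).

Lemma starE (X : irrOrthosetType) (Y : orthosetType) (f : adjMap X Y)
  (g : adjMap Y X) : is_adjoint f g -> star f = g.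
Proof.
move=> fg; apply: adjMap_eq => y; congr (_ y).
exact: is_adjoint_unique (star_funP f) fg.
Qed.

Lemma adj_compA (X Y Z T : irrOrthosetType)
    (h : adjMap Z T) (g : adjMap Y Z) (f : adjMap X Y) :
  adj_comp h (adj_comp g f) = adj_comp (adj_comp h g) f.
Proof. exact: adjMap_eq. Qed.

Lemma adj_comp1f (X Y : irrOrthosetType) (f : adjMap X Y) :
  adj_comp (adj_id Y) f = f.
Proof. exact: adjMap_eq. Qed.

Lemma adj_compf1 (X Y : irrOrthosetType) (f : adjMap X Y) :
  adj_comp f (adj_id X) = f.
Proof. exact: adjMap_eq. Qed.

Lemma star_id (X : irrOrthosetType) : star (adj_id X) = adj_id X.
Proof. exact: starE. Qed.

Lemma star_comp (X Y Z : irrOrthosetType) (g : adjMap Y Z) (f : adjMap X Y) :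
  star (adj_comp g f) = adj_comp (star f) (star g).
Proof. by apply: starE; apply: is_adjoint_comp; apply: star_funP. Qed.

Lemma starK (X Y : irrOrthosetType) (f : adjMap X Y) : star (star f) = f.
Proof. by apply: starE; apply/is_adjoint_sym/star_funP. Qed.

End AdjointableMaps.

Definition iOS : daggerCategory :=
  {| obj := irrOrthosetType;
     hom := fun X Y => adjMap X Y;
     idm := fun X => adj_id X;
     compm := fun X Y Z g f => adj_comp g f;
     dagger := fun X Y f => star f;
     compmA := adj_compA;
     comp1m := adj_comp1f;
     compm1 := adj_compf1;
     dagger_id := star_id;
     dagger_comp := star_comp;
     daggerK := starK |}.

(* The display is packed so that every complete ortholattice is an object. *)
Record cOL_obj := COLObj {
  cOL_display : Order.disp_t;
  cOL_sort :> completeOrtholatticeType cOL_display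
}.

Definition cOL : daggerCategory :=
  full_dagger_subcategory
    (fun L : cOL_obj => (lattice_orthoset L : irrOrthosetType) : iOS).

Definition C_obj (X : iOS) : cOL := COLObj (closedSet (X : irrOrthosetType)).

(* Main.v *)
(** An adjoint [g] of [f] satisfies [f(A)^perp = g^-1(A^perp)]. Hence
    [f(A)^perp] depends only on [A^perp], which gives functoriality, and
    [f(A)] is orthogonal to [B] iff [A] is orthogonal to [g(B)], which makes
    [C(g)] adjoint to [C(f)]. Faithfulness is read off from
    [C(f)({x}^perp^perp) = {f x}^perp^perp] by irredundancy. Finally, a closed
    subset of a complete ortholattice is the principal ideal of its supremum,
    and [A |-> sup A], with adjoint [a |-> {a}^perp^perp], is a dagger
    isomorphism from [C(L)] to [L]. *)
Require Import Defs.
From HB Require Import structures.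
From mathcomp Require Import all_boot all_order.
From mathcomp Require Import boolp classical_sets.

Import Order.TTheory.
Local Open Scope classical_set_scope.

Lemma orth_image {X Y : orthosetType} {f : X -> Y} {g : Y -> X}
    (fg : is_adjoint f g) (A : set X) :
  orth (f @` A) = g @^-1` orth A.
Proof.
apply/seteqP; split=> y yA => [x Ax|_ [x Ax <-]]; apply/perp_sym.
  by apply/fg/perp_sym/yA; exists x.
by apply/fg/perp_sym/yA.
Qed.

Lemma orth_image_orth2 {X Y : orthosetType} (f : adjMap X Y) (A : set X) :
  orth (f @` orth (orth A)) = orth (f @` A).
Proof. by rewrite !(orth_image (star_funP f)) orth3. Qed.

Lemma perp_closedSetE {X : irrOrthosetType}
    (A B : lattice_orthoset (closedSet X)) :
  perp A B <-> closed_set A `<=` orth (closed_set B).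
Proof. by split=> [/closedSet_leP|AB]; [|apply/closedSet_leP]. Qed.

(** Taken on bare functions so that it applies to an adjoint [g] not yet packaged as a morphism. *)
Definition cimage {X Y : irrOrthosetType} (f : X -> Y)
    (A : lattice_orthoset (closedSet X)) : lattice_orthoset (closedSet Y) :=
  corth (orth (f @` closed_set A)).

Lemma is_adjoint_cimage {X Y : irrOrthosetType} (f : X -> Y) (g : Y -> X) :
  is_adjoint f g -> is_adjoint (cimage f) (cimage g).
Proof.
move=> fg A B; rewrite !perp_closedSetE /= orth3.
rewrite (orth_image (is_adjoint_sym fg)).
split=> [AB x Ax|AB]; first by apply: AB; apply: orth_sub; exists x.
(* [orth B] is closed, so it contains the biorthogonal of [f(A)] once it contains [f(A)]. *)
rewrite -(orth3 (closed_set B)); do 2 apply: orthS.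
by move=> _ [x Ax <-]; apply: AB.
Qed.

Definition C_map {X Y : irrOrthosetType} (f : adjMap X Y) :
    adjMap (lattice_orthoset (closedSet X)) (lattice_orthoset (closedSet Y)) :=
  AdjMap (ex_intro _ _ (is_adjoint_cimage _ _ (star_funP f))).

Lemma C_map_id (X : irrOrthosetType) : C_map (adj_id X) = adj_id _.
Proof.
apply: adjMap_eq => A; apply: closedSet_inj.
by rewrite /= image_id closed_setP.
Qed.

Lemma C_map_comp (X Y Z : irrOrthosetType) (g : adjMap Y Z) (f : adjMap X Y) :
  C_map (adj_comp g f) = adj_comp (C_map g) (C_map f).
Proof.
apply: adjMap_eq => A; apply: closedSet_inj.
by rewrite /= orth_image_orth2 image_comp.
Qed.

Lemma C_map_star (X Y : irrOrthosetType) (f : adjMap X Y) :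
  C_map (star f) = star (C_map f).
Proof. exact/esym/starE/is_adjoint_cimage/star_funP. Qed.

(** Extends [irredundantP] to zero: a point with the same orthocomplement as zero is orthogonal to
    itself. *)
Lemma orth1_inj (X : irrOrthosetType) (x y : X) :
  orth [set x] = orth [set y] -> x = y.
Proof.
have orth0 (z : X) : orth [set ozero] = orth [set z] -> z = ozero.
  move=> E; apply/perpxx; suff: orth [set z] z by apply.
  by rewrite -E => _ ->; apply/perp_sym/perp0x.
have [->|x0] := pselect (x = ozero); first by move/orth0.
have [->|y0] := pselect (y = ozero); first by move/esym/orth0.
exact: irredundantP.
Qed.

Lemma C_map_inj (X Y : irrOrthosetType) (f g : adjMap X Y) :
  C_map f = C_map g -> f = g.
Proof.
move=> E; apply: adjMap_eq => x; apply: orth1_inj.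
(* One more orthocomplement strips the closures and leaves [orth [set f x] = orth [set g x]]. *)
have /(congr1 (fun A => orth (closed_set A))) :
  C_map f (corth (orth [set x])) = C_map g (corth (orth [set x])) by rewrite E.
by rewrite /= !orth3 !orth_image_orth2 !image_set1.
Qed.

Section SupremumIsomorphism.
Context {d : Order.disp_t} (L : completeOrtholatticeType d).
Local Notation LOS := (lattice_orthoset L).

Definition lsup (A : set L) : L := projT1 (cid (completeP A)).

Lemma lsup_le (A : set L) (b : L) :
  (lsup A <= b)%O <-> forall a, A a -> (a <= b)%O.
Proof.
rewrite /lsup; case: cid => s [/= ub lub]; split=> [sb a Aa|Ab].
  exact: le_trans (ub _ Aa) sb.
exact: lub.
Qed.

Definition csup (A : lattice_orthoset (closedSet LOS)) : LOS :=
  lsup (closed_set A).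

Definition cideal (b : LOS) : lattice_orthoset (closedSet LOS) :=
  corth (orth [set b]).

Lemma cidealE (b x : LOS) : closed_set (cideal b) x <-> ((x : L) <= (b : L))%O.
Proof.
split=> [xb|xb y /(_ b erefl) yb]; last first.
  exact: le_trans xb (perp_sym _ _ yb).
(* It suffices to test [x] against [ocompl b], the largest element orthogonal to [b]. *)
by rewrite -(ocomplK (b : L)); apply: xb => _ ->; apply: lexx.
Qed.

(** Both orthogality conditions say that [ocompl b] is an upper bound of [A]. *)
Lemma is_adjoint_csup : is_adjoint csup cideal.
Proof.
move=> A b; rewrite perp_closedSetE /= orth3.
split=> [/lsup_le Ab a Aa _ ->|Ab]; first exact: Ab.
by apply/lsup_le => a Aa; apply: Ab.
Qed.

Lemma csupK (A : lattice_orthoset (closedSet LOS)) : cideal (csup A) = A.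
Proof.
apply: closedSet_inj; apply/seteqP; split=> x; last first.
  by move=> Ax; apply/cidealE; have /lsup_le := lexx (csup A : L); apply.
(* For [y] in [orth A], [ocompl y] bounds [A], hence [csup A] and [x]; so [x] lies in the
   biorthogonal of [A]. *)
move/cidealE => xA; rewrite -(closed_setP A) => y yA.
apply: le_trans xA _; apply/lsup_le => a Aa.
exact: (perp_sym _ _ (yA a Aa)).
Qed.

Lemma cidealK (b : LOS) : csup (cideal b) = b.
Proof.
apply: (@le_anti _ L); apply/andP; split.
  by apply/lsup_le => a /cidealE.
have /lsup_le := lexx (csup (cideal b) : L); apply.
by apply/cidealE/lexx.
Qed.

End SupremumIsomorphism.

Theorem theorem6p7 :
  exists C_mor : forall X Y : iOS, hom X Y -> hom (C_obj X) (C_obj Y),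
    (forall (X Y : irrOrthosetType) (f : adjMap X Y) (A : closedSet X),
       C_mor X Y f A = orth (orth (f @` A)) :> set Y) /\
    is_functor C_mor /\
    faithful C_mor /\
    dagger_preserving C_mor /\
    dagger_essentially_surjective C_obj.
Proof.
exists (@C_map); split=> //.
split; first by split; [exact: C_map_id|exact: C_map_comp].
split; first exact: C_map_inj.
split; first exact: C_map_star.
(* The preimage of [L] is [L] itself, viewed as an orthoset. *)
move=> [d L]; exists (lattice_orthoset L : irrOrthosetType).
pose f : adjMap _ _ := AdjMap (ex_intro _ _ (is_adjoint_csup L)).
pose g : adjMap _ _ :=
  AdjMap (ex_intro _ _ (is_adjoint_sym (is_adjoint_csup L))).
(* [star f] is an adjoint picked by choice; uniqueness identifies it with [cideal]. *)
have fg : star f = g by apply: starE; exact: is_adjoint_csup.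
exists f; rewrite /dagger_isomorphism /= fg; split; apply: adjMap_eq.
  exact: csupK.
exact: cidealK.
Qed.
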